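(* Let $M$, $L=N_{(1)}\cup\dots\cup N_{(n)}\subset M$, $\mathcal L$, $\rho:\pi_1(M,x_0)\to G$ and the base points $x_0,\tilde x_0$ be as in the context. Let $\gamma,\alpha:\mathcal L\to G$ be two maps, each satisfying properties (1) and (2) of the context with respect to $\rho$, and suppose that $\gamma(L_i)\alpha(L_i)=\alpha(L_i)\gamma(L_i)$ for all $L_i\in\mathcal L$. Let $\gamma_{\mathcal E}$ and $\alpha_{\mathcal E}$ be the transported maps defined in the context. Then $$\mathcal E_{L,\gamma_{\mathcal E}}\bigl(\mathcal E_{L,\alpha}(\rho)\bigr)=\mathcal E_{L,\alpha_{\mathcal E}}\bigl(\mathcal E_{L,\gamma}(\rho)\bigr).$$
   Context: Setting. $M$ is a connected aspherical manifold (possibly with boundary) of dimension at least $2$ with finitely generated fundamental group and (contractible) universal cover $\widetilde M$. $L=N_{(1)}\cup\dots\cup N_{(n)}$ is a union of mutually disjoint, pairwise non-homotopic hypersurfaces; each $N_{(i)}$ is a connected, properly embedded, two-sided, aspherical hypersurface of $M$ such that $\pi_1(N_{(i)})\to\pi_1(M)$ is injective. Each $N_{(i)}$ is given an orientation, understood as a choice of positive transverse direction, and lifts carry the induced one. $\mathcal L=\{L_1,L_2,\dots\}$ is the set of connected components of the preimage of $L$ in $\widetilde M$; each $L_i$ separates $\widetilde M$ into two components. Base points: $\tilde x_0\in\widetilde M$ lying over $x_0\in M$, $x_0\notin L$. $\pi_1(M,x_0)$ acts on $\widetilde M$ by deck transformations, written as a right action: $\tilde x.(AB)=(\tilde x.A).B$.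 $T_i\subset\pi_1(M,x_0)$ is the subgroup preserving $L_i$. $G$ is an arbitrary Lie group and $\rho:\pi_1(M,x_0)\to G$ a homomorphism. Properties of a map $\gamma:\mathcal L\to G$ with respect to $\rho$: (1) $\gamma(L_i)\rho(A)=\rho(A)\gamma(L_i)$ for all $A\in T_i$; (2) if $A\in\pi_1(M,x_0)$ and $L_j=L_i.A$, then $\gamma(L_j)=\rho(A^{-1})\gamma(L_i)\rho(A)$. Deformation. A minimal path is a path transverse to the elements of $\mathcal L$ crossing each of them at most once. For $A\in\pi_1(M,x_0)$, a minimal path from $\tilde x_0$ to $\tilde x_0.A$ crosses a uniquely determined sequence $L_{a_1},\dots,L_{a_k}$ (in this order), with intersection signs $s_1,\dots,s_k\in\{\pm1\}$. Define $$\mathcal E_{L,\gamma}(\rho)(A)=\rho(A)\,\gamma(L_{a_k})^{s_k}\cdots\gamma(L_{a_1})^{s_1}.$$ The same formula is used with $\rho$ replaced by another map $\pi_1(M,x_0)\to G$ and $\gamma$ by another map $\mathcal L\to G$. Transported maps. For $L_i\in\mathcal L$, let $L_{b_1},\dots,L_{b_m}$ be the elements of $\mathcal L$ crossed, in order, by a minimal path from $\tilde x_0$ to $L_i$ (not including $L_i$ itself), with intersection signs $\epsilon_1,\dots,\epsilon_m$. Put $\xi_i^{\alpha}=\alpha(L_{b_m})^{\epsilon_m}\cdots\alpha(L_{b_1})^{\epsilon_1}$ and $\xi_i^{\gamma}=\gamma(L_{b_m})^{\epsilon_m}\cdots\gamma(L_{b_1})^{\epsilon_1}$. Then $$\gamma_{\mathcal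 E}(L_i)=(\xi_i^{\alpha})^{-1}\gamma(L_i)\,\xi_i^{\alpha},\qquad \alpha_{\mathcal E}(L_i)=(\xi_i^{\gamma})^{-1}\alpha(L_i)\,\xi_i^{\gamma}.$$ Here $\gamma_{\mathcal E}$ is used to deform $\mathcal E_{L,\alpha}(\rho)$, and $\alpha_{\mathcal E}$ to deform $\mathcal E_{L,\gamma}(\rho)$. *)

(* Defs.v *)
From HB Require Import structures.
From mathcomp Require Import all_boot all_order all_algebra.
From mathcomp Require Import all_classical all_reals all_analysis.

Set Implicit Arguments.
Unset Strict Implicit.
Unset Printing Implicit Defensive.

Import Order.TTheory GRing.Theory Num.Theory.
Import numFieldNormedType.Exports.

Local Open Scope classical_set_scope.
Local Open Scope ring_scope.

(* Everything is in the smooth category.  A path in X is a function R -> X of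
   which only the restriction to [0, 1] matters. *)
Notation "'I01'" := (`[0, 1]%classic) (only parsing).

Section Smoothness.
Variable R : realType.

(* C^k on an open set U, through iterated directional derivatives *)
Fixpoint Ck (V W : normedModType R) (k : nat) (f : V -> W) (U : set V) : Prop :=
  if k is k'.+1 then
    (forall x v, U x -> derivable f x v) /\
    (forall v, Ck k' (fun x => 'D_v f x) U)
  else forall x, U x -> {for x, continuous f}.

(* f is smooth on an arbitrary subset S: near every point of S it agrees on S
   with a C^oo function defined on an open set *)
Definition smooth_on (V W : normedModType R) (f : V -> W) (S : set V) : Prop :=
  forall x, S x -> exists (U : set V) (g : V -> W),
    [/\ open U, U x, forall k, Ck k g U & forall y, U y -> S y -> f y = g y].

(* e is the derivative at t of f restricted to [0, 1]
   (one-sided if t is an end point) *)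
Definition slope (f : R -> R) (t e : R) : Prop :=
  (fun u => (u - t)^-1 * (f u - f t)) @ within I01 t^' --> e.

End Smoothness.

Section Manifolds.
Variable R : realType.

(* [cmap] is only relevant on [cdom], [cinv] on [cmap @` cdom] *)
Record chart (X : Type) (V : normedModType R) := Chart {
  cdom : set X;
  cmap : X -> V;
  cinv : V -> X
}.

Variables (X : topologicalType) (V : normedModType R).
(* the local model: V itself, or a half-space of V *)
Variable (H : set V).

Definition is_chart (c : chart X V) : Prop :=
  [/\ open (cdom c),
      exists2 W : set V, open W & cmap c @` cdom c = H `&` W,
      forall x, cdom c x -> cinv c (cmap c x) = x,
      {within cdom c, continuous (cmap c)} &
      {within cmap c @` cdom c, continuous (cinv c)}].

Definition compatible (c c' : chart X V) : Prop :=
  smooth_on (fun v => cmap c' (cinv c v)) (cmap c @` (cdom c `&` cdom c')).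

Definition smooth_manifold (A : set (chart X V)) : Prop :=
  [/\ hausdorff_space X /\ @second_countable X,
      forall c, A c -> is_chart c,
      forall x, exists2 c, A c & cdom c x &
      forall c c', A c -> A c' -> compatible c c'].

(* membership in the maximal atlas generated by A *)
Definition smooth_chart (A : set (chart X V)) (c : chart X V) : Prop :=
  is_chart c /\ forall c', A c' -> compatible c c' /\ compatible c' c.

(* smoothness of the restriction of f to a subset S *)
Definition smooth_map_on (A : set (chart X V)) (f : X -> X) (S : set X) :=
  {within S, continuous f} /\
  forall a b, A a -> A b ->
    smooth_on (fun v => cmap b (f (cinv a v)))
              (cmap a @` (cdom a `&` S `&` f @^-1` cdom b)).

End Manifolds.

(* A group and a topology on the same carrier, not yet assumed compatible *)
#[short(type="groupTopologicalType")]
HB.structure Definition GroupTopological := {G of Group G & Topological G}.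

Definition lie_group (R : realType) (m : nat) (G : groupTopologicalType) : Prop :=
  exists A : set (chart G 'rV[R]_m),
  [/\ smooth_manifold setT A,
      continuous (fun z : G * G => (z.1 * z.2)%g),
      continuous (fun g : G => (g^-1)%g),
      forall a b c, A a -> A b -> A c ->
        smooth_on (fun z : 'rV[R]_m * 'rV[R]_m =>
                     cmap c (cinv a z.1 * cinv b z.2)%g)
          [set z | exists g h, [/\ cdom a g, cdom b h, cdom c (g * h)%g &
                                   z = (cmap a g, cmap b h)]] &
      forall a b, A a -> A b ->
        smooth_on (fun v => cmap b (cinv a v)^-1%g)
          (cmap a @` [set g | cdom a g /\ cdom b (g^-1)%g])].

Section Homotopy.
Variables (R : realType) (X : topologicalType).

Definition is_path (S : set X) (f : R -> X) (x y : X) : Prop :=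
  [/\ {within I01, continuous f}, f @` I01 `<=` S, f 0 = x & f 1 = y].

(* homotopy inside S, relative to the end points *)
Definition path_homotopic (S : set X) (f g : R -> X) : Prop :=
  exists h : R * R -> X,
  [/\ {within I01 `*` I01, continuous h},
      h @` (I01 `*` I01) `<=` S,
      forall t, I01 t -> h (0, t) = f t /\ h (1, t) = g t &
      forall s, I01 s -> h (s, 0) = f 0 /\ h (s, 1) = f 1].

Definition path_mul (f g : R -> X) : R -> X :=
  fun t => if t <= 2^-1 then f (2 * t) else g (2 * t - 1).

Definition simply_connected : Prop :=
  (forall x y, exists f, is_path setT f x y) /\
  (forall x f, is_path setT f x x -> path_homotopic setT f (cst x)).

Definition contractible : Prop :=
  exists (h : R * X -> X) (x : X),
    {within I01 `*` setT, continuous h} /\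
    forall y, h (0, y) = y /\ h (1, y) = x.

(* the Euclidean unit ball of R^(k+1) and its boundary k-sphere; the norm of
   'rV[R]_k.+1 is the sup norm *)
Definition unit_ball k : set 'rV[R]_k.+1 :=
  [set v | \sum_(i < k.+1) v ord0 i ^+ 2 <= 1].
Definition unit_sphere k : set 'rV[R]_k.+1 :=
  [set v | \sum_(i < k.+1) v ord0 i ^+ 2 = 1].
Arguments unit_ball : clear implicits.
Arguments unit_sphere : clear implicits.

(* pi_k (S) = 0 for all k >= 2 and all base points *)
Definition aspherical (S : set X) : Prop :=
  forall (k : nat) (f : 'rV[R]_k.+1 -> X), (2 <= k)%N ->
    {within unit_sphere k, continuous f} -> f @` unit_sphere k `<=` S ->
    exists g : 'rV[R]_k.+1 -> X,
    [/\ {within unit_ball k, continuous g}, g @` unit_ball k `<=` S &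
        forall v, unit_sphere k v -> g v = f v].

(* pi_1 (S, x) -> pi_1 (X, x) is injective for all x in S *)
Definition pi1_injective (S : set X) : Prop :=
  forall x f, is_path S f x x ->
    path_homotopic setT f (cst x) -> path_homotopic S f (cst x).

(* the group P, together with the map [cl] sending a loop to its class,
   is the fundamental group of X at x *)
Definition is_pi1 (x : X) (P : groupType) (cl : (R -> X) -> P) : Prop :=
  [/\ forall A, exists2 f, is_path setT f x x & cl f = A,
      forall f g, is_path setT f x x -> is_path setT g x x ->
        cl f = cl g <-> path_homotopic setT f g &
      forall f g, is_path setT f x x -> is_path setT g x x ->
        cl (path_mul f g) = (cl f * cl g)%g].

End Homotopy.

Definition finitely_generated (P : groupType) : Prop :=
  exists s : seq P, forall H : set P,
    H 1%g -> (forall A B, H A -> H B -> H (A * B)%g) ->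
    (forall A, H A -> H (A^-1)%g) -> (forall A, A \in s -> H A) ->
    H = setT.

Definition covering (Y X : topologicalType) (p : Y -> X) : Prop :=
  [/\ continuous p, forall x, exists y, p y = x &
      forall x, exists (U : set X) (F : set (set Y)),
      [/\ open U, U x, p @^-1` U = \bigcup_(S in F) S,
          forall S S', F S -> F S' -> S `&` S' !=set0 -> S = S' &
          forall S, F S ->
            [/\ open S, set_bij S U p &
                forall W, W `<=` S -> open W -> open (p @` W)]]].

Definition components (T : topologicalType) (A : set T) : set (set T) :=
  [set connected_component A x | x in A].

Section Hypersurfaces.
Variables (R : realType) (d : nat) (M : topologicalType).

(* The boundary is detected by the last coordinate; the first coordinate will
   be transverse to hypersurfaces.  They differ since the dimension is >= 2. *)
Definition half_space : set 'rV[R]_d.+2 := [set v | 0 <= v ord0 ord_max].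

Variable A : set (chart M 'rV[R]_d.+2).

Definition height (c : chart M 'rV[R]_d.+2) (x : M) : R := cmap c x ord0 ord0.

Definition slice_chart (N : set M) (c : chart M 'rV[R]_d.+2) : Prop :=
  smooth_chart half_space A c /\
  forall x, cdom c x -> N x <-> height c x = 0.

(* closed (i.e. the inclusion is proper) and locally a coordinate slice; at the
   points of the boundary of M, slice charts make N neat: its boundary is
   N `&` \partial M and it is transverse to \partial M *)
Definition properly_embedded_hypersurface (N : set M) : Prop :=
  closed N /\ forall x, N x -> exists2 c, slice_chart N c & cdom c x.

(* A choice of positive transverse direction along N, given by the slice charts
   c whose first coordinate increases in that direction: these cover N and
   agree on the positive side of N.  N is two-sided iff such a choice exists. *)
Definition co_orientation (N : set M) (P : set (chart M 'rV[R]_d.+2)) : Prop :=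
  [/\ forall c, P c -> slice_chart N c,
      forall x, N x -> exists2 c, P c & cdom c x &
      forall c c' x, P c -> P c' -> N x -> cdom c x -> cdom c' x ->
        \forall y \near x, (0 < height c y) = (0 < height c' y)].

Definition diffeo_between (N N' : set M) (f : M -> M) : Prop :=
  [/\ set_bij N N' f, smooth_map_on A f N &
      exists2 g, smooth_map_on A g N' & forall x, N x -> g (f x) = x].

(* the inclusions of N and N' are homotopic, up to identifying N with N' *)
Definition homotopic_hypersurfaces (N N' : set M) : Prop :=
  exists h : R * M -> M,
  [/\ {within I01 `*` N, continuous h},
      forall x, N x -> h (0, x) = x &
      diffeo_between N N' (fun x => h (1, x))].

End Hypersurfaces.

Record hypersurface_system (R : realType) (d n : nat) := HypersurfaceSystem {
  sM : topologicalType;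
  atlas : set (chart sM 'rV[R]_d.+2);
  (* the hypersurfaces N_(i), with their positively oriented slice charts *)
  hyp : 'I_n -> set sM;
  pos_charts : 'I_n -> set (chart sM 'rV[R]_d.+2);
  (* the universal cover and its base point *)
  sMt : topologicalType;
  covmap : sMt -> sM;
  xt0 : sMt;
  (* the fundamental group of M at covmap xt0, and its right action *)
  spi1 : groupType;
  loop_class : (R -> sM) -> spi1;
  deck_act : sMt -> spi1 -> sMt
}.

Arguments atlas {R d n} _.
Arguments hyp {R d n} _ _.
Arguments pos_charts {R d n} _ _.
Arguments covmap {R d n} _ _.
Arguments xt0 {R d n} _.
Arguments loop_class {R d n} _ _.
Arguments deck_act {R d n} _ _ _.

Section System.
Variables (R : realType) (d n : nat) (S : hypersurface_system R d n).
Local Notation M := (sM S).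
Local Notation Mt := (sMt S).
Local Notation P1 := (spi1 S).

Definition base_pt : M := covmap S (xt0 S).

Definition hyp_union : set M := \bigcup_(i in [set: 'I_n]) hyp S i.

(* the set \mathcal L *)
Definition lifts : set (set Mt) := components (covmap S @^-1` hyp_union).

Definition translate (L : set Mt) (A : P1) : set Mt := [set deck_act S x A | x in L].

(* Right action by deck transformations.  The last clause ties it to the
   identification of pi_1 with the deck group: the lift of a loop f ending at
   xt0 starts at xt0.[f].  With the product [f][g] = [f then g], this is the
   normalization for which xt0.(AB) = (xt0.A).B. *)
Definition deck_action : Prop :=
  [/\ forall x : Mt, deck_act S x 1%g = x,
      forall (x : Mt) (A B : P1), deck_act S x (A * B)%g = deck_act S (deck_act S x A) B,
      forall A : P1, continuous (fun x : Mt => deck_act S x A),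
      forall (x : Mt) (A : P1), covmap S (deck_act S x A) = covmap S x &
      forall (f : R -> Mt) (y : Mt), is_path setT f y (xt0 S) ->
        covmap S y = base_pt ->
        deck_act S (xt0 S) (loop_class S (fun t => covmap S (f t))) = y].

Record standing_assumptions : Prop := StandingAssumptions {
  M_manifold : smooth_manifold (@half_space R d) (atlas S);
  M_connected : connected [set: M];
  M_aspherical : aspherical R [set: M];
  pi1_fundamental : is_pi1 base_pt (loop_class S);
  pi1_fg : finitely_generated P1;
  cover_covering : covering (covmap S);
  cover_simply_connected : simply_connected R Mt;
  cover_contractible : contractible R Mt;
  act_deck : deck_action;
  hyp_nonempty : forall i, hyp S i !=set0;
  hyp_connected : forall i, connected (hyp S i);
  hyp_embedded : forall i,
    properly_embedded_hypersurface (atlas S) (hyp S i);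
  hyp_cooriented : forall i, co_orientation (atlas S) (hyp S i) (pos_charts S i);
  hyp_aspherical : forall i, aspherical R (hyp S i);
  hyp_pi1_injective : forall i, pi1_injective R (hyp S i);
  hyp_disjoint : forall i j, i != j -> hyp S i `&` hyp S j = set0;
  hyp_nonhomotopic : forall i j, i != j ->
    ~ homotopic_hypersurfaces (atlas S) (hyp S i) (hyp S j);
  base_pt_notin : ~ hyp_union base_pt;
  lifts_separate : forall L, lifts L ->
    exists U V, U <> V /\ components (~` L) = [set U; V]
}.

(* smooth for the smooth structure of the cover pulled back from M *)
Definition smooth_path (p : R -> Mt) : Prop :=
  {within I01, continuous p} /\
  forall c, atlas S c ->
    smooth_on (fun u : R^o => cmap c (covmap S (p u)))
              [set u : R^o | I01 u /\ cdom c (covmap S (p u))].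

(* At time t, p meets the preimage of L transversally; [s] tells whether the
   sign is +1 ([true]) or -1 ([false]).  Since lifts carry the induced
   co-orientation, this can be read on the projection of p to M. *)
Definition transverse_at (p : R -> Mt) (t : R) (s : bool) : Prop :=
  exists (i : 'I_n) c (e : R),
    [/\ hyp S i (covmap S (p t)), pos_charts S i c, cdom c (covmap S (p t)),
        slope (fun u => height c (covmap S (p u))) t e & e != 0 /\ s = (0 < e)].

Definition minimal_path (p : R -> Mt) : Prop :=
  [/\ smooth_path p,
      forall L t, lifts L -> I01 t -> L (p t) -> exists s, transverse_at p t s &
      forall L t t', lifts L -> I01 t -> I01 t' -> L (p t) -> L (p t') -> t = t'].

(* w lists, in order, the elements of \mathcal L crossed by p at times
   0 < t < 1, with their signs; an element on which p ends is not listed. *)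
Definition crossing_word (p : R -> Mt) (w : seq (lifts * bool)) : Prop :=
  exists tw : seq (R * (lifts * bool)),
    [/\ w = map snd tw,
        sorted (fun x y : R => x < y) (map fst tw),
        forall t, t \in map fst tw <-> 0 < t < 1 /\ hyp_union (covmap S (p t)) &
        forall z, z \in tw ->
          val z.2.1 (p z.1) /\ transverse_at p z.1 z.2.2].

(* The crossing word of a minimal path from xt0 to a point of E.  In both uses
   below it is uniquely determined: E is either {xt0.A} or an element of
   \mathcal L. *)
Definition word_to (E : set Mt) : seq (lifts * bool) :=
  xget [::] [set w | exists p, [/\ minimal_path p, p 0 = xt0 S, E (p 1) &
                                   crossing_word p w]].

Variable G : groupType.

Definition signed_pow (g : G) (s : bool) : G := if s then g else (g^-1)%g.

(* f(L_k)^(s_k) * ... * f(L_1)^(s_1) for the word (L_1, s_1), ..., (L_k, s_k) *)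
Definition word_prod (f : lifts -> G) (w : seq (lifts * bool)) : G :=
  foldl (fun g x => (signed_pow (f x.1) x.2 * g)%g) 1%g w.

Definition deformation (f : lifts -> G) (r : P1 -> G) : P1 -> G :=
  fun A => (r A * word_prod f (word_to [set deck_act S (xt0 S) A]))%g.

(* transported a g = g_E, the map g transported along a *)
Definition transported (a g : lifts -> G) : lifts -> G :=
  fun L => let xi := word_prod a (word_to (val L)) in (xi^-1 * g L * xi)%g.

Definition property1 (r : P1 -> G) (f : lifts -> G) : Prop :=
  forall (L : lifts) (A : P1), translate (val L) A = val L ->
    (f L * r A = r A * f L)%g.

Definition property2 (r : P1 -> G) (f : lifts -> G) : Prop :=
  forall (Li Lj : lifts) (A : P1), val Lj = translate (val Li) A ->
    (f Lj = r (A^-1) * f Li * r A)%g.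

End System.

Arguments lifts {R d n} S _.

(* Main.v *)
Require Import Defs.
From mathcomp Require Import all_boot all_order all_algebra.
From mathcomp Require Import all_classical all_reals all_analysis.
From mathcomp Require Import ring lra.

Set Implicit Arguments.
Unset Strict Implicit.
Unset Printing Implicit Defensive.
Import Order.TTheory GRing.Theory Num.Theory.
Import numFieldNormedType.Exports.
Local Open Scope classical_set_scope.
Local Open Scope ring_scope.

(** Both sides evaluate, at a class A, to rho(A) times a product over the same
    crossing word (L_1, s_1), ..., (L_k, s_k), that of a minimal path p from
    the base point to its translate by A.  The transported map conjugates
    gamma(L_i) by the alpha-product over the crossing word of a minimal path
    from the base point to L_i.  If that word is the prefix
    (L_1, s_1), ..., (L_(i-1), s_(i-1)), the conjugating factors telescope
    against the alpha-product of the whole word, which turns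
      alpha(L_k)^(s_k) ... alpha(L_1)^(s_1)
        * gamma_E(L_k)^(s_k) ... gamma_E(L_1)^(s_1)
    into the product of the alpha(L_i)^(s_i) gamma(L_i)^(s_i), i descending
    ([word_prod_exchange]).  This is symmetric in alpha and gamma as soon as
    alpha(L_i) and gamma(L_i) commute.

    It remains to see that the word of a minimal path to L_i is this prefix
    ([word_to_prefix]).  Stopping p when it reaches L_i gives a minimal path
    to L_i whose word is the prefix ([minimal_restrict],
    [crossing_word_restrict]), so the point is that two minimal paths from the
    base point to the same lift L have the same word ([word_unique]).  This is
    a separation argument.  A lift K has a positive and a negative side, which
    are the two components of its complement ([lift_separation]), and a path
    crossing K exactly once, transversally, changes sides there according to
    the sign of the crossing ([crossing]).  Hence
    - a minimal path to L crosses K iff K separates the base point from L, and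
      the sign is given by the side on which L lies ([word_mem]);
    - if K is crossed before K', then K lies on the side of K' where the path
      comes from, and K' on the side of K where it goes ([word_before]), which
      cannot hold in both orders.
    So the letters of the word and their order depend on L only.

    That the two local sides of K lie in different components rests on the
    following: the component met on the positive side is locally constant
    along the connected set K, and so is that met on the negative side.  If
    the two agreed, the other component would be open and closed in the
    connected universal cover. *)

(** * Connected sets *)

Lemma within_continuous_near (T U : topologicalType) (A : set T) (f : T -> U)
    (x : T) (Y : set U) :
  {within A, continuous f} -> A x -> nbhs (f x) Y ->
  \forall y \near x, A y -> Y (f y).
Proof. by move=> /subspace_continuousP cf Ax Yfx; exact: cf Ax _ Yfx. Qed.

Section Connectedness.
Variable T : topologicalType.
Implicit Types A C P N U V : set T.

Lemma connected_subclosure U A :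
  U `<=` A -> A `<=` closure U -> connected U -> connected A.
Proof.
move=> UA AU cU B [z Bz] [C oC BC] [D cD BD].
have UBU : U `&` C !=set0.
  have [Az Cz] : (A `&` C) z by rewrite -BC.
  exact: (AU z Az C (open_nbhs_nbhs (conj oC Cz))).
have UCD : U `&` C = U `&` D.
  by rewrite -(setIidl UA) -!setIA -BC -BD.
have UC : U `&` C = U by apply: cU UBU _ _; [exists C|exists D].
have UD : U `<=` D by move: UCD; rewrite UC => -> y [].
rewrite BD; apply: setIidl => y /AU; move: y.
by rewrite (closure_id D).1 //; exact: closureS.
Qed.

(** [P] and [N] may meet outside [C]: to spread a local property along a
    hypersurface, they are sets of points near which it holds or fails, and these
    exclude each other only at the points of the hypersurface. *)
Lemma connected_open_split C P N : connected C -> open P -> open N ->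
  C `<=` P `|` N -> (forall x, C x -> P x -> N x -> False) ->
  C `<=` P \/ C `<=` N.
Proof.
move=> cC oP oN CPN dPN; have [[x [Cx Px]]|CP0] := pselect (C `&` P !=set0).
  left; rewrite -[X in X `<=` _](cC (C `&` P)); first by move=> y [].
  - by exists x.
  - by exists P.
  - exists (~` N); first exact: open_closedC.
    apply/seteqP; split=> y [Cy]; first by move=> Py; split=> // /(dPN y Cy Py).
    by move=> Ny; split=> //; case: (CPN y Cy).
by right=> y Cy; case: (CPN y Cy) => // Py; case: CP0; exists y.
Qed.

Lemma components_disjoint A U V : components A U -> components A V ->
  U `&` V !=set0 -> U = V.
Proof.
move=> [x Ax <-] [y Ay <-] [z [xz yz]].
by rewrite (same_connected_component xz) (same_connected_component yz).
Qed.

(** A component is closed in [A] because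
    adding a limit point keeps it connected, and with only two components the
    complement of one is the other. *)
Lemma two_components A U V : open A -> U <> V -> components A = [set U; V] ->
  [/\ open U, open V, U `&` V = set0 & U `|` V = A].
Proof.
move=> oA UV AE.
have AU : components A U by rewrite AE; left.
have AV : components A V by rewrite AE; right.
have dUV : U `&` V = set0.
  by apply/eqP/negPn/negP => /set0P /(components_disjoint AU AV) /UV.
have sA : U `|` V = A.
  rewrite -[RHS]connected_component_cover -/(components A) AE bigcup_setU.
  by rewrite !bigcup_set1.
have closedin W : components A W -> closure W `&` A `<=` W.
  move=> [x Ax <-] y [cy Ay].
  have x_in := connected_component_refl Ax.
  apply: (@connected_component_max _ _ (connected_component A x `|` [set y])) => //.
  - by left.
  - by move=> z [/connected_component_sub //|->].
  - apply: connected_subclosure (@component_connected _ A x); first by left.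
    by move=> z [/subset_closure //|->].
  - by right.
have openin W W' : components A W -> W `&` W' = set0 -> W `|` W' = A -> open W'.
  move=> AW dW sW; rewrite (_ : W' = A `&` ~` closure W).
    by apply: openI oA _; exact/closed_openC/closed_closure.
  apply/seteqP; split=> y.
    move=> W'y; have Ay : A y by rewrite -sW; right.
    split=> // Wy; suff : set0 y by [].
    by rewrite -dW; split=> //; exact: closedin.
  move=> [Ay nWy]; have : (W `|` W') y by rewrite sW.
  by case=> // /subset_closure.
split=> //; first by apply: (openin V) => //; rewrite 1?setIC 1?setUC.
exact: (openin U).
Qed.

End Connectedness.

(** * Boxes in the cover *)

Section ChartBox.
Variables (R : realType) (d : nat) (M Mt : topologicalType) (p : Mt -> M).
Hypothesis p_cover : covering p.
Local Notation V := 'rV[R]_d.+2.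
Local Notation half_space := (@half_space R d).

(** The set is convex, hence a union of segments issuing from any of its
    points. *)
Lemma connected_slab (v0 : V) (r : R) (I : set R) : is_interval I ->
  connected (ball v0 r `&` half_space `&` [set v | I (v ord0 ord0)]).
Proof.
move=> Iint; set Q := (X in connected X).
have [[u Qu]|/forallNP Q0] := pselect (Q !=set0); last first.
  suff -> : Q = set0 by exact: connected0.
  by rewrite -subset0 => v /Q0.
pose seg v (t : R) : V := u + t *: (v - u).
have segE v t i : seg v t ord0 i = (1 - t) * u ord0 i + t * v ord0 i.
  rewrite /seg !mxE; ring.
have segQ v : Q v -> seg v @` `[0, 1] `<=` Q.
  move=> Qv _ [t + <-]; rewrite /= in_itv /= => /andP[t0 t1].
  have t1' : 0 <= 1 - t by rewrite subr_ge0.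
  case: Qu Qv => [[bu hu] Iu] [[bv hv] Iv].
  split; first split.
  - move: bu bv; rewrite -!ball_normE /= => bu bv.
    rewrite (_ : v0 - seg v t = (1 - t) *: (v0 - u) + t *: (v0 - v)); last first.
      by apply/matrixP => i j; rewrite !mxE; ring.
    apply: le_lt_trans (ler_normD _ _) _.
    rewrite !normrZ (ger0_norm t0) (ger0_norm t1').
    have [->|tn0] := eqVneq t 0; first by rewrite subr0 mul1r mul0r addr0.
    have tp : 0 < t by rewrite lt_def tn0.
    rewrite -[ltRHS](_ : (1 - t) * r + t * r = r); last by ring.
    by apply: ler_ltD; [apply: ler_wpM2l => //; exact: ltW|rewrite ltr_pM2l].
  - by rewrite /half_space /= segE addr_ge0 // mulr_ge0.
  - rewrite /= segE.
    have [le_uv|/ltW le_vu] := leP (u ord0 ord0) (v ord0 ord0).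
      by apply: (Iint _ _ Iu Iv); apply/andP; split; nra.
    by apply: (Iint _ _ Iv Iu); apply/andP; split; nra.
have -> : Q = \bigcup_(v in Q) (seg v @` `[0, 1]).
  apply/seteqP; split=> [v Qv|w [v Qv /(segQ v Qv)//]].
  exists v => //; exists 1; first by rewrite /= in_itv /= ler01 lexx.
  by rewrite /seg scale1r addrC subrK.
apply: bigcup_connected.
  exists u => v Qv; exists 0; first by rewrite /= in_itv /= lexx ler01.
  by rewrite /seg scale0r addr0.
move=> v Qv; apply: connected_continuous_connected; first exact: segment_connected.
apply: continuous_subspaceT => t.
apply: cvgD; first exact: cvg_cst.
by apply: cvgZr_tmp; exact: cvg_id.
Qed.

(** A piece of a sheet of the cover over a small ball of the half-space.  The last clause,
    applied to the open half-lines and to a single point, gives the connectedness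
    of the two halves of the box and of the slice between them. *)
Lemma chart_box (c : chart M V) (x : Mt) (Z : set Mt) :
  is_chart half_space c -> cdom c (p x) -> nbhs x Z ->
  exists (B : set Mt) (r : R),
  [/\ 0 < r, open B /\ B x, B `<=` Z `&` p @^-1` cdom c,
      (fun y => cmap c (p y)) @` B = ball (cmap c (p x)) r `&` half_space &
      forall I, is_interval I ->
        connected (B `&` [set y | I (height c (p y))])].
Proof.
move=> [odom [W oW imc] cinvK cmapC cinvC] cx Zx.
have [pC _ /(_ (p x)) [U [F [oU Ux pU _ FS]]]] := p_cover.
have [S SF Sx] : (\bigcup_(S in F) S) x by rewrite -pU.
have {FS} [oS [_ pinj _] popen] := FS S SF.
have {}pinj y z : S y -> S z -> p y = p z -> y = z.
  by move=> Sy Sz; apply: pinj; rewrite inE.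
pose S' := S `&` Z° `&` p @^-1` cdom c.
have oS' : open S'.
  apply: openI; first by apply: openI => //; exact: open_interior.
  by apply: open_comp => // y _; exact: pC.
have S'x : S' x by split=> //; split.
pose im := cmap c @` cdom c.
(* local section of p through the chart *)
pose sig v := xget x [set y | S y /\ p y = cinv c v].
have sigE y : S y -> cdom c (p y) -> sig (cmap c (p y)) = y.
  move=> Sy cy; rewrite /sig; case: xgetP => [z _ [Sz pz]|/(_ y) []].
    by apply: pinj => //; rewrite pz cinvK.
  by rewrite /= cinvK.
have im_near v1 y (Y : set Mt) : cdom c (p y) -> S y -> v1 = cmap c (p y) ->
    open Y -> Y y ->
    \forall v \near v1, im v -> exists z, [/\ S z, Y z & cinv c v = p z].
  move=> cy Sy -> oY Yy.
  have oE : open (p @` (S `&` Y)) by apply: popen; [move=> z []|exact: openI].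
  have imy : im (cmap c (p y)) by exists (p y).
  have : nbhs (cinv c (cmap c (p y))) (p @` (S `&` Y)).
    by apply: open_nbhs_nbhs; split=> //; rewrite cinvK //; exists y.
  move=> /(within_continuous_near cinvC imy); apply: filterS => v vE /vE.
  by move=> [z [Sz Yz] pz]; exists z.
have Wx : W (cmap c (p x)).
  suff : (half_space `&` W) (cmap c (p x)) by case.
  by rewrite -imc; exists (p x).
have : \forall v \near cmap c (p x), W v /\
    (im v -> exists z, [/\ S z, S' z & cinv c v = p z]).
  apply: filterI; first exact: open_nbhs_nbhs.
  by apply: (im_near _ x) => //; case: S'x => [[]].
move=> /nbhs_ballP [r /= r0 br].
pose B := S' `&` [set y | ball (cmap c (p x)) r (cmap c (p y))].
have surj v : ball (cmap c (p x)) r v -> half_space v ->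
    exists2 y, B y & cmap c (p y) = v.
  move=> bv hv; have [Wv] := br v bv.
  have imv : im v by rewrite /im imc.
  move=> /(_ imv) [z [Sz S'z vz]].
  have zv : cmap c (p z) = v by rewrite -vz; case: imv => m cm <-; rewrite cinvK.
  by exists z => //; split=> //=; rewrite zv.
have imB y : B y -> ball (cmap c (p x)) r (cmap c (p y)) /\ half_space (cmap c (p y)).
  move=> [[_ cy] by_]; split=> //.
  suff : (half_space `&` W) (cmap c (p y)) by case.
  by rewrite -imc; exists (p y).
exists B, r; split=> //.
- split; last by split=> //; exact: ballxx.
  have S'C : {in S', continuous (fun y => cmap c (p y))}.
    move=> y /set_mem [_ cy]; apply: (@continuous_comp _ _ _ p (cmap c)); first exact: pC.
    by move: cmapC; rewrite continuous_open_subspace // => /(_ (p y)); apply; rewrite inE.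
  rewrite openE => y [S'y by_].
  apply: filterI; first by exact: open_nbhs_nbhs.
  by apply: (S'C y); [rewrite inE|apply: open_nbhs_nbhs; split=> //; exact: ball_open].
- by move=> y [[[_ Zy] cy] _]; split=> //; exact: interior_subset.
- apply/seteqP; split=> [_ [y By <-]|v [bv hv]]; first exact: imB.
  by have [y By yv] := surj v bv hv; exists y.
- move=> I Iint.
  set Q := ball (cmap c (p x)) r `&` half_space `&` [set v | I (v ord0 ord0)].
  rewrite (_ : B `&` _ = sig @` Q).
    apply: connected_continuous_connected; first exact: connected_slab.
    apply/subspace_continuousP => v [[bv hv] Iv].
    have [y By yv] := surj v bv hv.
    have [[[Sy _] cy] _] := By.
    have sigv : sig v = y by rewrite -yv sigE.
    rewrite /from_subspace sigv => Y /= Yy.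
    have := im_near v y Y° cy Sy (esym yv) (open_interior _) Yy.
    rewrite nbhs_simpl /=; apply: filterS => w wP [[bw hw] Iw].
    have [z Bz zw] := surj w bw hw.
    have [[[Sz _] cz] _] := Bz.
    have [|z' [Sz' Yz' wz']] := wP; first by exists (p z).
    rewrite /= -zw sigE //; suff -> : z = z' by exact: interior_subset.
    by apply: pinj => //; rewrite -wz' -zw cinvK.
  apply/seteqP; split=> [y [By Iy]|_ [v [[bv hv] Iv] <-]].
    exists (cmap c (p y)); first by split=> //; exact: imB.
    by case: By => [[[Sy _] cy] _]; rewrite sigE.
  have [y By yv] := surj v bv hv.
  by have [[[Sy _] cy] _] := By; rewrite -yv sigE //; split=> //=; rewrite /height yv.
Qed.

End ChartBox.

(** * The two sides of a lift *)

Lemma nbhsI (T : topologicalType) (x : T) (A B : set T) :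
  nbhs x A -> nbhs x B -> nbhs x (A `&` B).
Proof. by move=> xA xB; exact: filterI. Qed.

Section Lifts.
Variables (R : realType) (d n : nat) (S : hypersurface_system R d n).
Hypothesis hS : standing_assumptions S.
Local Notation Mt := (sMt S).
Local Notation cov := (covmap S).
Local Notation hypU := (@hyp_union _ _ _ S).
Implicit Types (K L : set Mt) (x y : Mt) (b e : bool) (i j : 'I_n).

Lemma cov_continuous : continuous cov.
Proof. by have [] := cover_covering hS. Qed.

Lemma hyp_inj i j (z : sM S) : hyp S i z -> hyp S j z -> i = j.
Proof.
move=> iz jz; apply/eqP/negPn/negP => /(hyp_disjoint hS) ij.
by suff : set0 z by []; rewrite -ij.
Qed.

Lemma lift_connected K : lifts S K -> connected K.
Proof. by move=> [x _ <-]; exact: component_connected. Qed.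

Lemma lift_sub K : lifts S K -> K `<=` cov @^-1` hypU.
Proof. by move=> [x _ <-]; exact: connected_component_sub. Qed.

Lemma lift_nonempty K : lifts S K -> K !=set0.
Proof. by move=> [x Ax <-]; exists x; exact: connected_component_refl. Qed.

Lemma lift_closed K : lifts S K -> closed K.
Proof.
move=> [x _ <-]; apply: component_closed; apply: closed_comp => [y _|].
  exact: cov_continuous.
apply: closed_bigcup => [|i _]; first exact: finite_finset.
by have [] := hyp_embedded hS i.
Qed.

Lemma lifts_eq K L y : lifts S K -> lifts S L -> K y -> L y -> K = L.
Proof. by move=> hK hL Ky Ly; apply: components_disjoint hK hL _; exists y. Qed.

(** The hypersurfaces are finitely many disjoint closed sets, so each of them
    is open in their union. *)
Lemma lift_in_hyp K : lifts S K -> exists i, K `<=` cov @^-1` hyp S i.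
Proof.
move=> hK; have [x Kx] := lift_nonempty hK; have [i _ ix] := lift_sub hK Kx.
exists i; pose N := \bigcup_(j in [set j | j <> i]) hyp S j.
have hypC j : closed (hyp S j) by have [] := hyp_embedded hS j.
have cN : closed N.
  by apply: closed_bigcup => [|j _]; [exact: finite_finset|exact: hypC].
have openpre (C : set (sM S)) : closed C -> open (cov @^-1` ~` C).
  by move=> cC; apply: open_comp => [y _|]; [exact: cov_continuous|exact: closed_openC].
have [] := @connected_open_split _ K _ _ (lift_connected hK) (openpre _ cN)
  (openpre _ (hypC i)).
- move=> y Ky; have [j _ jy] := lift_sub hK Ky.
  have [ji|ji] := pselect (j = i); [left=> -[k ki ky]|right=> iy].
    by apply: ki; rewrite -ji; exact: hyp_inj ky jy.
  by apply: ji; exact: hyp_inj jy iy.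
- move=> y Ky Ny iy; have [j _ jy] := lift_sub hK Ky.
  have [ji|ji] := pselect (j = i); first by apply: iy; rewrite -ji.
  by apply: Ny; exists j.
- move=> KN y Ky; have [j _ jy] := lift_sub hK Ky.
  have [<- //|ji] := pselect (j = i).
  by case: (KN y Ky); exists j.
- by move=> /(_ x Kx).
Qed.

Definition on_side b (h : R) : Prop := if b then 0 < h else h < 0.

Lemma on_side_interval b : is_interval [set h : R | on_side b h].
Proof.
case: b => u v /= hu hv z /andP[uz zv] //=; first exact: lt_le_trans hu uz.
exact: le_lt_trans zv hv.
Qed.

(** In a small box, [K] is the whole slice of height [0]: the slice is connected
    and meets the component [K].  The two halves of the box are nonempty even at
    the boundary of the manifold, since the height is the first coordinate while
    the boundary is seen by the last one. *)
Lemma lift_local K i c x (Z : set Mt) : lifts S K -> K x -> hyp S i (cov x) ->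
  slice_chart (atlas S) (hyp S i) c -> cdom c (cov x) -> nbhs x Z ->
  exists B : set Mt,
  [/\ open B /\ B x, B `<=` Z, B `<=` cov @^-1` cdom c,
      forall y, B y -> K y <-> height c (cov y) = 0 &
      forall b, let Bb := B `&` [set y | on_side b (height c (cov y))] in
        connected Bb /\ Bb !=set0].
Proof.
move=> hK Kx ix [[cc _] cN] cx Zx.
have [j Kj] := lift_in_hyp hK.
have {j Kj} Ki : K `<=` cov @^-1` hyp S i.
  by rewrite (hyp_inj ix (Kj _ Kx)).
have [B [r [r0 [oB Bx] BZ imB conB]]] := chart_box (cover_covering hS) cc cx Zx.
have BZ' : B `<=` Z by move=> y /BZ [].
have Bc : B `<=` cov @^-1` cdom c by move=> y /BZ [].
have KB y : B y -> K y <-> height c (cov y) = 0.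
  move=> By; split=> [Ky|hy]; first by apply/cN; [exact: Bc|exact: Ki].
  have c0 : connected (B `&` [set z | [set (0 : R)] (height c (cov z))]).
    apply: conB => u v /= -> -> z /andP[uz zv].
    by apply/eqP; rewrite eq_le uz zv.
  case: (hK) => z Az Kz; rewrite -Kz.
  have zx : connected_component (cov @^-1` hypU) z x by rewrite Kz.
  rewrite (same_connected_component zx).
  apply: (@connected_component_max _ _ (B `&` [set z | [set (0 : R)] (height c (cov z))])) => //.
    by split=> //=; apply/cN.
  move=> t [Bt ht]; exists i => //; apply/cN => //; exact: Bc.
exists B; split=> // b Bb; split; first by apply: conB; exact: on_side_interval.
have hx0 : height c (cov x) = 0 by apply/cN.
(* move from x in the direction of the first coordinate *)
pose s : R := (if b then 1 else -1) * (r / 2).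
pose v : 'rV[R]_d.+2 := cmap c (cov x) + s *: delta_mx 0 0.
have [_ hhx] : (ball (cmap c (cov x)) r `&` @half_space R d) (cmap c (cov x)).
  by rewrite -imB; exists x.
have : (ball (cmap c (cov x)) r `&` @half_space R d) v.
  split.
    split=> // k l; rewrite /ball /= /v !mxE opprD addNKr normrN normrM.
    apply: (@le_lt_trans _ _ `|s|).
      by rewrite ler_piMr //; case: (_ && _); rewrite ?normr1 ?normr0.
    rewrite /s normrM [`|if _ then _ else _|](_ : _ = 1).
      by rewrite mul1r gtr0_norm; lra.
    by case: (b); rewrite ?normrN normr1.
  by rewrite /half_space /= /v !mxE /= mulr0 addr0.
rewrite -imB => -[y By yv]; exists y; split=> //=.
rewrite /height yv /v !mxE -/(height c (cov x)) hx0 add0r eqxx mulr1 /s.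
by rewrite /on_side; case: (b); lra.
Qed.

(** A labelling of the two components of the complement of [K], [sd true] being
    the side towards which the co-orientation points all along [K]. *)
Definition separation K (sd : bool -> set Mt) : Prop :=
  [/\ forall b, open (sd b), forall y, sd true y -> sd false y -> False,
      ~` K = sd true `|` sd false &
      forall i c x b, K x -> hyp S i (cov x) -> pos_charts S i c ->
        cdom c (cov x) ->
        \forall y \near x, on_side b (height c (cov y)) -> sd b y].

Lemma near_cdom i c (z : sM S) : pos_charts S i c -> cdom c z ->
  \forall y \near z, cdom c y.
Proof.
move=> ic cz; have [+ _ _] := hyp_cooriented hS i.
by move=> /(_ c ic) [[[oc _ _ _ _] _] _]; exact: open_nbhs_nbhs.
Qed.

(** For the negative side this uses that both heights vanish exactly on the
    hypersurface, a co-orientation comparing only the positive sides. *)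
Lemma on_side_chart i c c' x b : pos_charts S i c -> pos_charts S i c' ->
  hyp S i (cov x) -> cdom c (cov x) -> cdom c' (cov x) ->
  \forall y \near x, on_side b (height c (cov y)) -> on_side b (height c' (cov y)).
Proof.
move=> ic ic' ix cx c'x; have [sl _ /(_ c c' (cov x) ic ic' ix cx c'x) co] := hyp_cooriented hS i.
suff : \forall z \near cov x, on_side b (height c z) -> on_side b (height c' z).
  exact: cov_continuous.
near=> y; have cy : cdom c y by near: y; exact: near_cdom ic cx.
have c'y : cdom c' y by near: y; exact: near_cdom ic' c'x.
have coy : (0 < height c y) = (0 < height c' y) by near: y.
case: b; rewrite /on_side; first by rewrite -coy.
move=> hy; rewrite lt_neqAle leNgt -coy -leNgt (ltW hy) andbT.
apply/eqP; rewrite -(sl _ ic').2 // (sl _ ic).2 // => h0.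
by rewrite h0 ltxx in hy.
Unshelve. all: by end_near. Qed.

(** [G b e] consists of the points of [K] near which the half of sign [b] lies
    in the component [comp e].  These sets are open and, for fixed [b], disjoint
    along the connected [K], so that each half lies in one component. *)
Lemma lift_separation K : lifts S K -> exists sd, separation K sd.
Proof.
move=> hK; have [U [V [UV KE]]] := lifts_separate hS hK.
have [oU oV dUV sUV] := two_components (closed_openC (lift_closed hK)) UV KE.
have [i Ki] := lift_in_hyp hK.
have [sl cover_i _] := hyp_cooriented hS i.
pose comp e := if e then U else V.
have oC e : open (comp e) by case: e.
have dC e y : comp e y -> comp (~~ e) y -> False.
  by case: e => /= Uy Vy; suff : set0 y by []; rewrite -dUV.
have sC e y : ~ K y -> comp e y \/ comp (~~ e) y.
  by move=> Ky; have : (U `|` V) y by [rewrite sUV]; case: e => -[]; tauto.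
have nK e y : comp e y -> ~ K y.
  by move=> Cy; suff : (~` K) y by []; rewrite -sUV; case: e Cy; [left|right].
pose G b e := [set x | exists c, [/\ pos_charts S i c, cdom c (cov x) &
  \forall y \near x, on_side b (height c (cov y)) -> comp e y]].
have oG b e : open (G b e).
  rewrite openE => x [c [ic cx xc]].
  have cnx : \forall y \near x, cdom c (cov y).
    exact: cov_continuous (near_cdom ic cx).
  have xc' := nbhs_interior xc; near=> y; exists c; split=> //.
    by near: y; exact: cnx.
  by near: y; exact: xc'.
have meet x c b (Z : set Mt) : K x -> pos_charts S i c -> cdom c (cov x) ->
    nbhs x Z -> exists2 y, Z y & on_side b (height c (cov y)).
  move=> Kx ic cx Zx.
  have [B [_ BZ _ _ /(_ b) [_ [y [By yb]]]]] := lift_local hK Kx (Ki _ Kx) (sl _ ic) cx Zx.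
  by exists y => //; exact: BZ.
have G_indep x b e c : K x -> G b e x -> pos_charts S i c -> cdom c (cov x) ->
    \forall y \near x, on_side b (height c (cov y)) -> comp e y.
  move=> Kx [c' [ic' c'x xc']] ic cx.
  have := nbhsI xc' (on_side_chart b ic ic' (Ki _ Kx) cx c'x).
  by apply: filterS => y [h1 h2] /h2.
have splitG b : exists e, K `<=` G b e.
  have [] := @connected_open_split _ K _ _ (lift_connected hK) (oG b true) (oG b false).
  - move=> x Kx; have [c ic cx] := cover_i _ (Ki _ Kx).
    have [B [[oB Bx] _ _ KB /(_ b) [cB _]]] :=
      lift_local hK Kx (Ki _ Kx) (sl _ ic) cx (filterT : nbhs x setT).
    have [] := connected_open_split cB oU oV.
    + rewrite sUV => y [By yb] Ky; move: yb; rewrite /= (KB y By).1 //.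
      by case: (b); rewrite /on_side ltxx.
    + by move=> y _ Uy Vy; apply: (dC true y).
    + move=> BU; left; exists c; split=> //.
      by apply: filterS (open_nbhs_nbhs (conj oB Bx)) => y By yb; exact: BU.
    + move=> BV; right; exists c; split=> //.
      by apply: filterS (open_nbhs_nbhs (conj oB Bx)) => y By yb; exact: BV.
  - move=> x Kx GU GV; have [c ic cx] := cover_i _ (Ki _ Kx).
    have := nbhsI (G_indep _ _ _ _ Kx GU ic cx) (G_indep _ _ _ _ Kx GV ic cx).
    by move=> /(meet _ _ b _ Kx ic cx) [y [h1 h2] yb]; apply: (dC true y); auto.
  - by exists true.
  - by exists false.
have [et Ket] := splitG true; have [ef Kef] := splitG false.
have etf : ef = ~~ et.
  apply/eqP/negPn/negP => /negP neq; have {neq} ete : ef = et.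
    by case: (ef) (et) neq => -[].
  (* both halves in the same component: the other one is open and closed *)
  subst ef; pose X := comp (~~ et).
  have oX : open (~` X).
    rewrite openE => y nXy; have [Ky|nKy] := pselect (K y); last first.
      have Cy : comp et y by have [] := sC et _ nKy.
      by apply: filterS (open_nbhs_nbhs (conj (oC et) Cy)) => z /dC.
    have [c ic cy] := cover_i _ (Ki _ Ky).
    have [B [[oB By] _ _ KB _]] :=
      lift_local hK Ky (Ki _ Ky) (sl _ ic) cy (filterT : nbhs y setT).
    have hB := open_nbhs_nbhs (conj oB By).
    have := nbhsI hB (nbhsI (G_indep _ _ _ _ Ky (Ket y Ky) ic cy)
                                (G_indep _ _ _ _ Ky (Kef y Ky) ic cy)).
    apply: filterS => z [Bz [h1 h2]] Xz.
    have nKz := nK _ _ Xz; have [h|h|h] := ltrgtP (height c (cov z)) 0.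
    - by apply: (dC et z) => //; exact: h2.
    - by apply: (dC et z) => //; exact: h1.
    - by apply: nKz; apply/KB.
  have Cn e : comp e !=set0.
    suff : components (~` K) (comp e).
      by move=> [y Ay <-]; exists y; exact: connected_component_refl.
    by rewrite KE; case: (e); [left|right].
  (* a path between the two components would have to leave the clopen set X *)
  have [x Cx] := Cn et; have [y Xy] := Cn (~~ et).
  have [f [cf _ f0 f1]] := (cover_simply_connected hS).1 x y.
  have cI := connected_continuous_connected (@segment_connected R 0 1) cf.
  have [] := connected_open_split cI oX (oC (~~ et)).
  - by move=> z _; have [Xz|Xz] := pselect (X z); [right|left].
  - by move=> z _.
  - move=> /(_ y) h; apply: h Xy; exists 1 => //.
    by rewrite /= in_itv /= ler01 lexx.
  - move=> /(_ x) h; apply: (dC et x) => //; apply: h; exists 0 => //.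
    by rewrite /= in_itv /= ler01 lexx.
have KG b : K `<=` G b (if b then et else ~~ et).
  by case: b => //; rewrite -etf.
exists (fun b => comp (if b then et else ~~ et)); split.
- by move=> b; exact: oC.
- by move=> y; exact: dC.
- apply/seteqP; split=> y; first by move=> /(sC et) [Cy|Cy]; [left|right].
  by move=> [/nK|/nK].
- move=> j c x b Kx jx; rewrite (hyp_inj jx (Ki _ Kx)) => ic cx.
  by apply: G_indep => //; exact: KG.
Unshelve. all: by end_near. Qed.

End Lifts.

(** * Crossing words of minimal paths *)

Section Crossings.
Variables (R : realType) (d n : nat) (S : hypersurface_system R d n).
Hypothesis hS : standing_assumptions S.
Local Notation Mt := (sMt S).
Local Notation cov := (covmap S).
Local Notation hypU := (@hyp_union _ _ _ S).
Implicit Types (K L : set Mt) (p q : R -> Mt) (b s : bool) (t u r : R).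
Variable sd : set Mt -> bool -> set Mt.
Hypothesis sdP : forall K, lifts S K -> separation K (sd K).

Lemma side_inj K y b b' : lifts S K -> sd K b y -> sd K b' y -> b = b'.
Proof.
move=> hK; have [_ dK _ _] := sdP hK.
by case: b b' => -[] // y1 y2; case: (dK y).
Qed.

Lemma side_out K y b : lifts S K -> sd K b y -> ~ K y.
Proof.
move=> hK yb; have [_ _ sK _] := sdP hK.
by suff : (~` K) y by []; rewrite sK; case: b yb; [left|right].
Qed.

Lemma connected_one_side K (C : set Mt) : lifts S K -> connected C ->
  (forall y, C y -> ~ K y) -> exists b, C `<=` sd K b.
Proof.
move=> hK cC CK; have [oK dK sK _] := sdP hK.
have [] := connected_open_split cC (oK true) (oK false).
- by move=> y /CK; rewrite -sK.
- by move=> y _; exact: dK.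
- by exists true.
- by exists false.
Qed.

Lemma lift_one_side K L y b : lifts S K -> lifts S L -> K <> L ->
  L y -> sd K b y -> L `<=` sd K b.
Proof.
move=> hK hL KL Ly yb.
have [|b' Lb'] := connected_one_side hK (lift_connected hL).
  by move=> z Lz Kz; apply: KL; exact: lifts_eq hK hL Kz Lz.
by rewrite (side_inj hK yb (Lb' y Ly)).
Qed.

Lemma path_one_side p K (I : set R) : lifts S K -> {within I01, continuous p} ->
  is_interval I -> I `<=` I01 -> (forall u, I u -> ~ K (p u)) ->
  exists b, forall u, I u -> sd K b (p u).
Proof.
move=> hK cp Iint I01I IK.
have cI : connected (p @` I).
  apply: connected_continuous_connected; first exact/connected_intervalP.
  exact: continuous_subspaceW cp.
have [|b Ib] := connected_one_side hK cI; first by move=> _ [u Iu <-]; exact: IK.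
by exists b => u Iu; apply: Ib; exists u.
Qed.

(** A path crossing a lift with sign [s] is on the side [s] after the crossing
    and on the opposite side before. *)
Definition side_after (s after : bool) : bool := if after then s else ~~ s.

(** The height along the path vanishes at [t] and has a nonzero slope there. *)
Lemma crossing_near p K t s : lifts S K -> {within I01, continuous p} ->
  I01 t -> K (p t) -> transverse_at p t s ->
  \forall u \near t, I01 u -> forall b, on_side b (u - t) ->
    sd K (side_after s b) (p u).
Proof.
move=> hK cp It Kt [i [c [e [iK ic ct sl [e0 se]]]]].
have [_ _ _ /(_ i c (p t)) sK] := sdP hK.
have [slc _ _] := hyp_cooriented hS i.
have h0 : height c (cov (p t)) = 0 by apply/(slc _ ic).2.
have nb b := within_continuous_near cp It (sK b Kt iK ic ct).
have se' : on_side s e.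
  by rewrite se /on_side; case: ltrgtP e0 => //.
have ne : nbhs e [set h | on_side s h].
  apply: open_nbhs_nbhs; split=> //; case: (s); [exact: open_gt|exact: open_lt].
have := sl _ ne; rewrite nbhs_simpl /= h0 => near_sl.
near=> u => Iu b ub.
have ut : u != t.
  by apply: contraTneq isT => ut; move: ub; rewrite ut subrr /on_side; case: (b); rewrite ltxx.
have nbu : forall b', on_side b' (height c (cov (p u))) -> sd K b' (p u).
  have nbt : I01 u -> on_side true (height c (cov (p u))) -> sd K true (p u).
    by near: u; exact: nb.
  have nbf : I01 u -> on_side false (height c (cov (p u))) -> sd K false (p u).
    by near: u; exact: nb.
  by case; [exact: nbt|exact: nbf].
apply: nbu.
have slu : u != t -> I01 u -> on_side s ((u - t)^-1 * (height c (cov (p u)) - 0)).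
  by near: u; exact: near_sl.
have := slu ut Iu; rewrite subr0; move: ub; rewrite /on_side /side_after.
case: (b) (s) => -[] ub.
- by rewrite pmulr_rgt0 // invr_gt0.
- by rewrite pmulr_rlt0 // invr_gt0.
- by rewrite nmulr_rgt0 // invr_lt0.
- by rewrite nmulr_rlt0 // invr_lt0.
Unshelve. all: by end_near. Qed.

(** On either side of [t] the path avoids [K], so the side found near [t]
    persists. *)
Lemma crossing p K t s : lifts S K -> minimal_path p ->
  I01 t -> K (p t) -> transverse_at p t s ->
  forall u b, I01 u -> on_side b (u - t) -> sd K (side_after s b) (p u).
Proof.
move=> hK [[cp _] _ p1] It Kt tr u b Iu ub.
have [b' b'P] : exists b', forall v, [set v | I01 v /\ on_side b (v - t)] v ->
    sd K b' (p v).
  apply: path_one_side => //; last 2 first.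
  - by move=> v [].
  - move=> v [Iv vb] Kv; move: vb; rewrite (p1 K v t) // subrr /on_side.
    by case: (b); rewrite ltxx.
  move=> v w [Iv vb] [Iw wb] z vzw.
  move: Iv Iw vzw vb wb; rewrite /= !in_itv /= /on_side.
  move=> /andP[v0 v1] /andP[w0 w1] /andP[vz zw].
  have -> : (0 <= z <= 1)%R by apply/andP; split; lra.
  by case: (b) => vb wb; split=> //; lra.
(* v lies between t and u, close enough to t *)
have := crossing_near hK cp It Kt tr => /nbhs_ballP [e /= e0 be].
have uE : sd K b' (p u) by apply: b'P; split.
pose a := Num.min 1 (e / 2); pose v := t + a * (u - t).
have a0 : 0 < a by rewrite lt_min; apply/andP; split; lra.
have a1 : a <= 1 by rewrite ge_min lexx.
have ae : a <= e / 2 by rewrite ge_min lexx orbT.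
have [t0 t1] : 0 <= t /\ t <= 1 by move: It; rewrite /= in_itv /= => /andP.
have [u0 u1] : 0 <= u /\ u <= 1 by move: Iu; rewrite /= in_itv /= => /andP.
have Iv : I01 v by rewrite /= in_itv /= /v; apply/andP; split; nra.
have vb : on_side b (v - t).
  move: ub; rewrite /v addrAC subrr add0r /on_side.
  by case: (b); [rewrite pmulr_rgt0|rewrite pmulr_rlt0].
suff vE : sd K (side_after s b) (p v).
  by rewrite (side_inj hK vE (b'P v (conj Iv vb))).
apply: be => //=; rewrite -ball_normE /= /v opprD addNKr normrN normrM gtr0_norm //.
have : `|u - t| <= 1 by rewrite ler_norml; apply/andP; split; lra.
have := normr_ge0 (u - t); nra.
Qed.

Lemma base_notin K : lifts S K -> ~ K (xt0 S).
Proof. by move=> hK /(lift_sub hK); exact: base_pt_notin hS. Qed.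

Lemma I01_0 : I01 (0 : R).
Proof. by rewrite /= in_itv /= lexx ler01. Qed.

Lemma I01_1 : I01 (1 : R).
Proof. by rewrite /= in_itv /= lexx ler01. Qed.

Lemma I01_lt t : 0 < t < 1 -> I01 t.
Proof. by move=> /andP[/ltW t0 /ltW t1]; rewrite /= in_itv /= t0 t1. Qed.

Hint Resolve I01_0 I01_1 : core.

(** The right-hand side does not mention the path: [K] is crossed, with sign
    [s], iff it separates the base point from [L] in the direction [s]. *)
Lemma word_mem p L w (K : lifts S) s : minimal_path p -> p 0 = xt0 S ->
  lifts S L -> L (p 1) -> crossing_word p w ->
  (K, s) \in w <->
    [/\ val K <> L, sd (val K) (~~ s) (xt0 S) & L `<=` sd (val K) s].
Proof.
move=> mp p0 hL Lp [tw [-> _ twt twP]].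
have hK (K' : lifts S) : lifts S (val K') by exact: (set_valP K').
have fwd z : z \in tw -> [/\ val z.2.1 <> L,
    sd (val z.2.1) (~~ z.2.2) (xt0 S) & L `<=` sd (val z.2.1) z.2.2].
  move=> ztw; have [zt _] : 0 < z.1 < 1 /\ hypU (cov (p z.1)).
    by apply/twt; exact: map_f.
  have [Kz trz] := twP z ztw; have /andP[z0 z1] := zt.
  have KL : val z.2.1 <> L.
    move=> KL; have [_ _ /(_ L z.1 1 hL (I01_lt zt) I01_1)] := mp.
    by rewrite -{1}KL => /(_ Kz Lp) zE; rewrite zE ltxx in z1.
  have cr := crossing (hK _) mp (I01_lt zt) Kz trz.
  split=> //.
    by rewrite -p0; apply: (cr 0 false) => //; rewrite /on_side; lra.
  apply: lift_one_side KL Lp _ => //.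
  by apply: (cr 1 true) => //; rewrite /on_side; lra.
split=> [/mapP[z ztw zE]|[KL x0K LK]].
  by have := fwd z ztw; rewrite -zE.
have [[t [It Kt]]|noK] := pselect (exists t, I01 t /\ val K (p t)); last first.
  have [[cp _] _ _] := mp.
  have [|||b bP] := path_one_side (hK K) cp (I := `[0, 1]%classic).
  - exact: interval_is_interval.
  - by [].
  - by move=> u Iu Ku; apply: noK; exists u.
  have e0 := side_inj (hK K) (bP 0 I01_0); rewrite p0 in e0.
  have := side_inj (hK K) (bP 1 I01_1) (LK _ Lp).
  by rewrite (e0 _ x0K); case: (s).
have [z ztw zt] : exists2 z, z \in tw & t = z.1.
  suff /mapP [z ztw ->] : t \in map fst tw by exists z.
  apply/twt; split; last exact: (lift_sub (hK K)).
  move: It; rewrite /= in_itv /= => /andP[t0 t1].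
  rewrite !lt_neqAle t0 t1 !andbT; apply/andP; split; apply/eqP => tE.
    by apply: (base_notin (hK K)); rewrite -p0 tE.
  by apply: KL; apply: lifts_eq (hK K) hL _ Lp; rewrite -tE.
have [Kz _] := twP z ztw.
have KE : z.2.1 = K.
  by apply: val_inj; apply: lifts_eq (hK _) (hK _) Kz _; rewrite -zt.
have [_ x0z _] := fwd z ztw; rewrite KE in x0z.
have := side_inj (hK K) x0z x0K => /(can_inj negbK) sE.
by apply/mapP; exists z => //; rewrite -KE -sE; case: (z) => ? [].
Qed.

(** Behind [y] and beyond [x], with respect to the direction of crossing.  Both
    inclusions are kept to make the relation antisymmetric. *)
Definition before (x y : lifts S * bool) : bool :=
  `[< val x.1 `<=` sd (val y.1) (~~ y.2) /\ val y.1 `<=` sd (val x.1) x.2 >].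

Lemma word_before p w : minimal_path p -> crossing_word p w -> pairwise before w.
Proof.
move=> mp [tw [-> + twt twP]].
have hK (K' : lifts S) : lifts S (val K') by exact: (set_valP K').
rewrite sorted_pairwise; last exact: lt_trans.
rewrite !pairwise_map; apply: (@sub_in_pairwise _ (mem tw)); last by apply/allP.
move=> x y xtw ytw /= xy.
have zt z : z \in tw -> 0 < z.1 < 1.
  by move=> ztw; apply: (proj1 ((twt z.1).1 _)); exact: map_f.
have [Kx trx] := twP x xtw; have [Ky try_] := twP y ytw.
have Ix := I01_lt (zt x xtw); have Iy := I01_lt (zt y ytw).
have KL : val x.2.1 <> val y.2.1.
  move=> KL; have [_ _ /(_ (val x.2.1) x.1 y.1 (hK _) Ix Iy Kx)] := mp.
  by rewrite KL => /(_ Ky) E; rewrite E ltxx in xy.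
apply/asboolP; split.
  apply: lift_one_side Kx _ => //; first exact: nesym.
  by apply: (crossing _ mp Iy Ky try_ (b := false)) => //; rewrite /on_side subr_lt0.
apply: lift_one_side Ky _ => //.
by apply: (crossing _ mp Ix Kx trx (b := true)) => //; rewrite /on_side subr_gt0.
Qed.

(** Two enumerations of the same letters, both increasing for the antisymmetric
    relation [before]. *)
Lemma word_unique p q L w w' : lifts S L ->
  minimal_path p -> p 0 = xt0 S -> L (p 1) -> crossing_word p w ->
  minimal_path q -> q 0 = xt0 S -> L (q 1) -> crossing_word q w' ->
  w = w'.
Proof.
move=> hL mp p0 p1 pw mq q0 q1 qw.
have hK (K' : lifts S) : lifts S (val K') by exact: (set_valP K').
have pbw := word_before mp pw; have pbw' := word_before mq qw.
have irr : irreflexive before.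
  move=> x; apply/asboolP => -[+ _]; have [y Ky] := lift_nonempty (hK x.1).
  by move=> /(_ y Ky) /(side_out (hK _)).
have anti : antisymmetric before.
  move=> x y /andP[/asboolP [_ yx] /asboolP [yx' _]].
  have [z Kz] := lift_nonempty (hK y.1).
  by have := side_inj (hK _) (yx z Kz) (yx' z Kz); case: (x.2).
apply: (pairwise_eq anti pbw pbw').
apply: uniq_perm; [exact: pairwise_uniq irr pbw|exact: pairwise_uniq irr pbw'|].
move=> [K s]; apply/idP/idP => [/(word_mem K s mp p0 hL p1 pw)|/(word_mem K s mq q0 hL q1 qw)] h.
  exact/(word_mem K s mq q0 hL q1 qw).
exact/(word_mem K s mp p0 hL p1 pw).
Qed.

End Crossings.

(** * Initial segments of minimal paths *)

Section Rescaling.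
Variables (R : realType) (W : normedModType R) (t : R).

(** Difference quotients in the direction [v] at [u], after rescaling, are
    literally those in the direction [t * v] at [t * u]: iterated derivatives are
    transported without the chain rule. *)
Lemma scale_quotient (f : R^o -> W) (v u : R^o) :
  (fun h : R => h^-1 *: (((fun z : R^o => f (t * z)) \o shift u) (h *: v) - f (t * u))) =
  (fun h : R => h^-1 *: ((f \o shift (t * u : R^o)) (h *: (t * v : R^o)) - f (t * u))).
Proof.
apply/funext => h /=; congr (_ *: (f _ - _)).
by rewrite /GRing.scale /=; ring.
Qed.

Lemma Ck_scale k (f : R^o -> W) (U : set R^o) : Ck k f U ->
  Ck k (fun u : R^o => f (t * u)) [set u | U (t * u)].
Proof.
elim: k f => [|k IH] f /=.
  move=> cf u Uu; apply: (@continuous_comp _ _ _ (fun u : R^o => t * u : R^o) f).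
    exact: mulrl_continuous.
  exact: cf.
move=> [df Df]; split=> [u v Uu|v].
  by have := df _ (t * v) Uu; rewrite /derivable -scale_quotient.
rewrite (_ : (fun u => _) = fun u : R^o => (fun z => 'D_(t * v : R^o) f z) (t * u)).
  exact: IH (Df _).
by apply/funext => u; rewrite /derive -scale_quotient.
Qed.

Lemma smooth_on_scale (f : R^o -> W) (A B : set R^o) :
  (forall u, B u -> A (t * u)) -> smooth_on f A ->
  smooth_on (fun u => f (t * u)) B.
Proof.
move=> BA sf u Bu; have [U [g [oU Uu Cg fg]]] := sf _ (BA u Bu).
exists [set u | U (t * u)], (fun u => g (t * u)); split=> //.
- by apply: open_comp oU => v _; exact: mulrl_continuous.
- by move=> k; exact: Ck_scale.
- by move=> v Uv Bv; apply: fg => //; exact: BA.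
Qed.

Lemma slope_scale (f : R -> R) (r e : R) : 0 < t <= 1 ->
  slope f (t * r) e -> slope (fun u => f (t * u)) r (t * e).
Proof.
move=> /andP[t0 t1] sl; have tn0 : t != 0 by rewrite gt_eqF.
rewrite /slope.
have -> : (fun u => (u - r)^-1 * (f (t * u) - f (t * r))) =
          (fun u => t * ((t * u - t * r)^-1 * (f (t * u) - f (t * r)))).
  by apply/funext => u; rewrite -mulrBr invfM !mulrA divff // mul1r.
apply: cvgMl_tmp => P /sl; rewrite !nbhs_simpl /= => sP.
have tr : t * u @[u --> r] --> t * r by exact: mulrl_continuous.
suff : \forall u \near r, u != r -> I01 u ->
  P ((t * u - t * r)^-1 * (f (t * u) - f (t * r))) by [].
have := tr _ sP; rewrite nbhs_simpl /=; apply: filterS => u /= uP ur Iu; apply: uP.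
  by apply: contra_neq ur; exact: mulfI.
by move: Iu; rewrite /= !in_itv /= => /andP[u0 u1]; apply/andP; split; nra.
Qed.

End Rescaling.

Section Restriction.
Variables (R : realType) (d n : nat) (S : hypersurface_system R d n).
Local Notation Mt := (sMt S).
Local Notation cov := (covmap S).
Variables (p : R -> Mt) (t : R).
Hypothesis t01 : 0 < t < 1.
Local Notation q := (fun u => p (t * u)).

Lemma I01_scale u : I01 u -> I01 (t * u).
Proof.
have /andP[t0 t1] := t01.
by rewrite /= !in_itv /= => /andP[u0 u1]; apply/andP; split; nra.
Qed.

Lemma transverse_restrict u s : transverse_at p (t * u) s -> transverse_at q u s.
Proof.
have /andP[t0 /ltW t1] := t01.
move=> [i [c [e [iq ic cq sl [e0 se]]]]]; exists i, c, (t * e); split=> //.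
  by apply: (slope_scale (f := fun u => height c (cov (p u)))) => //; rewrite t0.
by split; [rewrite mulf_neq0 // gt_eqF|rewrite pmulr_rgt0].
Qed.

Lemma minimal_restrict : minimal_path p -> minimal_path q.
Proof.
have /andP[t0 _] := t01.
move=> [[cp sp] trp p1]; split; first split.
- apply/subspace_continuousP => u Iu Y /= Yu.
  have := within_continuous_near cp (I01_scale Iu) Yu.
  move=> pY; have := mulrl_continuous pY; rewrite !nbhs_simpl /=.
  by apply: filterS => v vY Iv; apply: vY; exact: I01_scale.
- move=> c cA; apply: smooth_on_scale (sp c cA) => u [Iu cu].
  by split=> //; exact: I01_scale.
- move=> L u hL Iu Lu; have [s trs] := trp L _ hL (I01_scale Iu) Lu.
  by exists s; exact: transverse_restrict.
- move=> L u v hL Iu Iv Lu Lv.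
  apply: (@mulfI _ t); first by rewrite gt_eqF.
  by apply: p1 hL _ _ Lu Lv; exact: I01_scale.
Qed.

Lemma crossing_word_restrict tw1 (x : lifts S * bool) tw2 :
  let tw := tw1 ++ (t, x) :: tw2 in
  sorted (fun u v : R => u < v) (map fst tw) ->
  (forall u, u \in map fst tw <-> 0 < u < 1 /\ @hyp_union _ _ _ S (cov (p u))) ->
  (forall z, z \in tw -> val z.2.1 (p z.1) /\ transverse_at p z.1 z.2.2) ->
  crossing_word q (map snd tw1).
Proof.
move=> tw; have /andP[t0 t1] := t01.
have tn0 : t != 0 by rewrite gt_eqF.
move=> + twt twP; rewrite sorted_pairwise ?map_cat; last exact: lt_trans.
rewrite pairwise_cat /= => /and3P[/allrelP lt12 so1 /andP[/allP lt2 _]].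
have tw1E u : u \in map fst tw1 <-> u < t /\ u \in map fst tw.
  rewrite map_cat mem_cat /= inE; split=> [u1|[ut]].
    by rewrite u1; split=> //; apply: lt12; rewrite ?inE ?eqxx.
  case/or3P=> // [/eqP ut'|/lt2 tu]; first by rewrite ut' ltxx in ut.
  by have := lt_trans ut tu; rewrite ltxx.
exists [seq (z.1 / t, z.2) | z <- tw1]; split.
- by rewrite -map_comp.
- rewrite -map_comp (_ : map _ _ = map (fun u => u / t) (map fst tw1)).
    rewrite sorted_map sorted_pairwise; last by move=> u v w; exact: lt_trans.
    apply: sub_pairwise so1 => u v /= uv.
    by rewrite ltr_pM2r // invr_gt0.
  by rewrite -map_comp.
- move=> u.
  have -> : (u \in map fst [seq (z.1 / t, z.2) | z <- tw1]) = (t * u \in map fst tw1).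
    rewrite -map_comp; apply/mapP/mapP => [[z ztw ->]|[z ztw zE]]; exists z => //=.
      by rewrite mulrC divfK.
    by rewrite -zE mulrC mulKf.
  split=> [/tw1E[ut /twt[/andP[u0 u1] ?]]|[/andP[u0 u1] hu]].
    by split=> //; apply/andP; split; nra.
  by apply/tw1E; split; [nra|apply/twt; split=> //; apply/andP; split; nra].
- move=> _ /mapP [z ztw ->] /=.
  have /twP [Kz trz] : z \in tw by rewrite mem_cat ztw.
  have zE : t * (z.1 / t) = z.1 by rewrite mulrC divfK.
  by split; [rewrite zE|apply: transverse_restrict; rewrite zE].
Qed.

End Restriction.

(** The initial segment of [p] shows that some minimal path to the lift has the
    word [u]; uniqueness shows that any other has the same one. *)
Lemma word_to_prefix (R : realType) (d n : nat) (S : hypersurface_system R d n)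
    (hS : standing_assumptions S) (p : R -> sMt S) (u v : seq (lifts S * bool))
    (x : lifts S * bool) :
  minimal_path p -> p 0 = xt0 S -> crossing_word p (u ++ x :: v) ->
  word_to (val x.1) = u.
Proof.
move=> mp p0 [tw [wE so twt twP]].
have [tw1 [t [tw2 [twE uE]]]] : exists tw1 t tw2,
    tw = tw1 ++ (t, x) :: tw2 /\ u = map snd tw1.
  have := cat_take_drop (size u) tw.
  have : map snd (drop (size u) tw) = x :: v by rewrite map_drop -wE drop_size_cat.
  have : map snd (take (size u) tw) = u by rewrite map_take -wE take_size_cat.
  case: (drop _ _) => // -[t y] tw2 uE [<- _] twE.
  by exists (take (size u) tw), t, tw2.
have t01 : 0 < t < 1.
  by apply: (proj1 ((twt t).1 _)); rewrite twE map_cat mem_cat /= inE eqxx orbT.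
have Lt : val x.1 (p t).
  have xtw : (t, x) \in tw by rewrite twE mem_cat inE eqxx orbT.
  by have [] := twP _ xtw.
pose q r := p (t * r).
have mq : minimal_path q by exact: minimal_restrict.
have qu : crossing_word q u.
  by rewrite uE; move: so twt twP; rewrite twE; exact: crossing_word_restrict.
have q0 : q 0 = xt0 S by rewrite /q mulr0.
have q1 : val x.1 (q 1) by rewrite /q mulr1.
have /choice [sd sdP] : forall K, exists sd, lifts S K -> separation K sd.
  move=> K; have [hK|] := pselect (lifts S K); last by exists (fun _ _ => True).
  by have [sd] := lift_separation hS hK; exists sd.
rewrite /word_to; case: xgetP => [w _ [q' [mq' q'0 q'1 qw']]|/(_ u) []].
  by apply: word_unique hS _ sdP _ _ _ _ _ _ mq' q'0 q'1 qw' mq q0 q1 qu; exact: set_valP.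
by exists q; split.
Qed.

(** * Exchanging the two deformations *)

Section WordProducts.
Variables (R : realType) (d n : nat) (S : hypersurface_system R d n).
Variable G : groupType.
Implicit Types (f g : lifts S -> G) (w : seq (lifts S * bool)).
Local Open Scope group_scope.

Lemma word_prod_rcons f w x :
  word_prod f (rcons w x) = signed_pow (f x.1) x.2 * word_prod f w.
Proof. by rewrite /word_prod foldl_rcons. Qed.

Lemma signed_powJ (g z : G) s :
  signed_pow (z^-1 * g * z) s = z^-1 * signed_pow g s * z.
Proof. by case: s => //=; rewrite !invgM invgK mulgA. Qed.

Lemma signed_pow_commute (g h : G) s : g * h = h * g ->
  signed_pow g s * signed_pow h s = signed_pow h s * signed_pow g s.
Proof. by case: s => //= gh; rewrite -!invgM gh. Qed.

(** By induction on [w]: the last letter [x] contributes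
    f(x) z (z^-1 g(x) z) = f(x) g(x) z, where z is the f-product over the
    preceding letters. *)
Lemma word_prod_exchange f g w :
  (forall K, f K * g K = g K * f K) ->
  (forall u x v, w = u ++ x :: v -> word_to (val x.1) = u) ->
  word_prod f w * word_prod (transported f g) w =
  word_prod g w * word_prod (transported g f) w.
Proof.
move=> fg; elim/last_ind: w => [//|w x IH] prefix.
rewrite !word_prod_rcons /transported (prefix w x [::]) ?cats1 // !signed_powJ.
have cancel (a z b y : G) : a * z * (z^-1 * b * z * y) = a * b * (z * y).
  by rewrite !mulgA mulgK.
rewrite !cancel signed_pow_commute // -/(transported f g) -/(transported g f) IH //.
by move=> u y v wE; apply: (prefix u y (rcons v x)); rewrite wE rcons_cat.
Qed.

End WordProducts.

Theorem theorem2p9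
  (R : realType) (d n : nat) (S : hypersurface_system R d n)
  (hS : standing_assumptions S)
  (m : nat) (G : groupTopologicalType) (hG : lie_group R m G)
  (rho : {multiplicative spi1 S -> G})
  (gamma alpha : lifts S -> G)
  (gamma1 : property1 rho gamma) (gamma2 : property2 rho gamma)
  (alpha1 : property1 rho alpha) (alpha2 : property2 rho alpha)
  (comm : forall L : lifts S, (gamma L * alpha L = alpha L * gamma L)%g) :
  deformation (transported alpha gamma) (deformation alpha rho) =
  deformation (transported gamma alpha) (deformation gamma rho).
Proof.
apply/funext => A; rewrite /deformation -!mulgA; congr (_ * _)%g.
(* without a minimal path the word is empty and both products are trivial *)
rewrite /word_to; case: xgetP => [w _ [p [mp p0 _ pw]]|_]; last by rewrite !mulg1.
apply: word_prod_exchange => [K|u x v wE]; first by rewrite comm.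
rewrite wE in pw; exact: (word_to_prefix hS mp p0 pw).
Qed.
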